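(* Let $d,n\in\mathbb{N}$ with $d,n\geq 1$, let $\theta\in[0,2\pi)$, and let $\mathbb{R}^d$ carry the standard inner product $\langle\cdot,\cdot\rangle$ and the Euclidean norm. Let $f_1,\dots,f_n\in(\mathbb{R}^d)^*$ and $\tau_1,\dots,\tau_n\in\mathbb{R}^d$. Then the pair $(\{f_j\}_{j=1}^n,\{\tau_j\}_{j=1}^n)$ is an $(n,\theta)$-functional code in $\mathbb{R}^d$ if and only if $\{\tau_j\}_{j=1}^n$ is a $(d,n,\theta)$-spherical code in $\mathbb{R}^d$ and $f_j(x)=\langle x,\tau_j\rangle$ for all $x\in\mathbb{R}^d$ and all $1\leq j\leq n$.
   Context: Functional code: Let $\mathcal{X}$ be a real Banach space with dual $\mathcal{X}^*$. For $1\leq j\leq n$ let $f_j\in\mathcal{X}^*$ and $\tau_j\in\mathcal{X}$. The pair $(\{f_j\}_{j=1}^n,\{\tau_j\}_{j=1}^n)$ is an $(n,\theta)$-functional code in $\mathcal{X}$ if: (i) $\|f_j\|=1$ for all $1\leq j\leq n$ (dual norm); (ii) $\|\tau_j\|=1$ for all $1\leq j\leq n$; (iii) $f_j(\tau_j)=1$ for all $1\leq j\leq n$; (iv) $f_j(\tau_k)\leq\cos\theta$ for all $1\leq j,k\leq n$ with $j\neq k$. Spherical code: An indexed family $\{\tau_j\}_{j=1}^n$ of unit vectors in $\mathbb{R}^d$ (Euclidean norm) is a $(d,n,\theta)$-spherical code in $\mathbb{R}^d$ if $\langle\tau_j,\tau_k\rangle\leq\cos\theta$ for all $1\leq j,k\leq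 n$ with $j\neq k$. *)

(* Defs.v *)
From HB Require Import structures.
From mathcomp Require Import all_boot all_order all_algebra.
From mathcomp Require Import all_classical all_reals all_analysis.
From mathcomp Require Import ring lra.

Set Implicit Arguments.
Unset Strict Implicit.
Unset Printing Implicit Defensive.

Import Order.TTheory GRing.Theory Num.Theory.
Import numFieldNormedType.Exports.

Local Open Scope classical_set_scope.
Local Open Scope ring_scope.

Record dual (R : realType) (X : normedModType R) := Dual {
  dual_fun :> {linear X -> R^o};
  dual_continuous : continuous dual_fun
}.

Definition dual_norm (R : realType) (X : normedModType R) (f : dual X) : R :=
  sup [set `|f x| | x in [set x : X | `|x| <= 1]].

(* [sup] is 0 on unbounded sets; this never happens in [dual_norm]. *)
Lemma dual_norm_has_sup (R : realType) (X : normedModType R) (f : dual X) :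
  has_sup [set `|f x| | x in [set x : X | `|x| <= 1]].
Proof.
split; first by exists `|f 0|, 0 => //=; rewrite normr0.
have /linear_boundedP/pinfty_ex_gt0[r r0 fr] : bounded_near f (nbhs (0 : X)).
  by apply/linear_bounded_continuous; exact: dual_continuous.
exists r => _ [x /= x1 <-]; apply: le_trans (fr x) _.
by rewrite ler_piMr// ltW.
Qed.

Definition functional_code (R : realType) (X : completeNormedModType R)
    (n : nat) (theta : R) (f : 'I_n -> dual X) (tau : 'I_n -> X) : Prop :=
  [/\ forall j, dual_norm (f j) = 1,
      forall j, `|tau j| = 1,
      forall j, f j (tau j) = 1 &
      forall j k, j != k -> f j (tau k) <= cos theta].

(* The library norm of ['rV[R]_d] is the sup norm, hence the alias [euclid],
   which keeps the linear structure of ['rV[R]_d] but has the Euclidean norm. *)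
Definition euclid (R : realType) (d : nat) : Type := 'rV[R]_d.

HB.instance Definition _ (R : realType) (d : nat) :=
  GRing.Lmodule.copy (euclid R d) 'rV[R]_d.

Definition inner (R : realType) (d : nat) (x y : euclid R d) : R :=
  \sum_(i < d) x 0 i * y 0 i.

Definition l2norm (R : realType) (d : nat) (x : euclid R d) : R :=
  Num.sqrt (inner x x).

Section euclid_theory.
Variables (R : realType) (d : nat).
Implicit Types x y z : euclid R d.

Lemma innerC x y : inner x y = inner y x.
Proof. by apply: eq_bigr => i _; rewrite mulrC. Qed.

Lemma innerDl x y z : inner (x + y) z = inner x z + inner y z.
Proof. by rewrite -big_split; apply: eq_bigr => i _; rewrite mxE mulrDl. Qed.

Lemma innerZl (a : R) x y : inner (a *: x) y = a * inner x y.
Proof. by rewrite mulr_sumr; apply: eq_bigr => i _; rewrite mxE mulrA. Qed.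

Lemma inner_ge0 x : 0 <= inner x x.
Proof. by apply: sumr_ge0 => i _; rewrite -expr2 sqr_ge0. Qed.

Lemma inner_eq0 x : inner x x = 0 -> x = 0.
Proof.
move=> /eqP; rewrite psumr_eq0; last by move=> i _; rewrite -expr2 sqr_ge0.
move=> /allP x0; apply/rowP => i; rewrite mxE.
by apply/eqP; rewrite -[_ == _]orbb -mulf_eq0; apply: x0; rewrite mem_index_enum.
Qed.

Lemma l2norm_ge0 x : 0 <= l2norm x.
Proof. exact: sqrtr_ge0. Qed.

Lemma sqr_l2norm x : l2norm x ^+ 2 = inner x x.
Proof. by rewrite sqr_sqrtr// inner_ge0. Qed.

Lemma l2norm0_eq0 x : l2norm x = 0 -> x = 0.
Proof. by move=> x0; apply: inner_eq0; rewrite -sqr_l2norm x0 expr0n. Qed.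

Lemma l2normZ (a : R) x : l2norm (a *: x) = `|a| * l2norm x.
Proof.
rewrite /l2norm innerZl innerC innerZl mulrA -expr2 sqrtrM ?sqr_ge0//.
by rewrite sqrtr_sqr.
Qed.

Lemma inner_le x y : inner x y <= l2norm x * l2norm y.
Proof.
have [->|y0] := eqVneq y 0.
  by rewrite innerC -(scale0r (0 : euclid R d)) innerZl mul0r mulr_ge0 ?l2norm_ge0.
have [->|x0] := eqVneq x 0.
  by rewrite -(scale0r (0 : euclid R d)) innerZl mul0r mulr_ge0 ?l2norm_ge0.
have pos z : z != 0 -> 0 < l2norm z.
  by move=> z0; rewrite lt_neqAle l2norm_ge0 andbT eq_sym;
     apply: contra_neq z0 => /l2norm0_eq0.
have := inner_ge0 (l2norm y *: x + (- l2norm x) *: y).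
rewrite !innerDl !innerZl !(innerC _ (_ + _)) !innerDl !innerZl.
rewrite (innerC y x) -!sqr_l2norm => h.
have {h} : 0 <= 2 * (l2norm x * l2norm y) * (l2norm x * l2norm y - inner x y).
  by apply: le_trans h _; rewrite le_eqVlt; apply/orP; left; apply/eqP; ring.
by rewrite pmulr_rge0 ?subr_ge0// !mulr_gt0 ?pos.
Qed.

Lemma l2normD x y : l2norm (x + y) <= l2norm x + l2norm y.
Proof.
rewrite -ler_sqr ?nnegrE ?addr_ge0 ?l2norm_ge0// sqr_l2norm.
rewrite innerDl !(innerC _ (_ + _)) !innerDl (innerC y x) -!sqr_l2norm.
have := inner_le x y; rewrite sqrrD; lra.
Qed.

End euclid_theory.

HB.instance Definition _ (R : realType) (d : nat) :=
  @Lmodule_isNormed.Build R (euclid R d) (@l2norm R d)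
    (@l2normD R d) (@l2normZ R d) (@l2norm0_eq0 R d).

Section euclid_complete.
Variables (R : realType) (d : nat).
Implicit Types x y : euclid R d.

Lemma euclid_normE x : `|x| = l2norm x.
Proof. by []. Qed.

Lemma coord_le_norm x i : `|x 0 i| <= `|x|.
Proof.
rewrite euclid_normE -sqrtr_sqr /l2norm /inner ler_sqrt; last exact: inner_ge0.
rewrite (bigD1 i)//= -expr2 lerDl.
by apply: sumr_ge0 => j _; rewrite -expr2 sqr_ge0.
Qed.

Lemma norm_le_sum_coord x : `|x| <= \sum_(i < d) `|x 0 i|.
Proof.
have s0 : 0 <= \sum_(i < d) `|x 0 i| by exact: sumr_ge0.
rewrite -ler_sqr ?nnegrE// euclid_normE sqr_l2norm /inner expr2 mulr_suml.
apply: ler_sum => i _; rewrite -expr2 -real_normK ?num_real// expr2.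
by rewrite ler_wpM2l// (bigD1 i)//= lerDl sumr_ge0.
Qed.

Lemma euclid_cauchy_cvg (F : set_system (euclid R d)) :
  ProperFilter F -> cauchy F -> cvg F.
Proof.
move=> FF /cauchy_ballP Fc.
have /cauchy_cvg/cvg_ex[/= l Fl] : @cauchy 'rV[R]_d F.
  apply/(@cauchy_ballP R 'rV[R]_d) => e e0; apply: filterS (Fc e e0).
  move=> -[x y]; rewrite /= -ball_normE /= => xy.
  split=> // i j; rewrite (ord1 i) -ball_normE /=.
  apply: le_lt_trans xy; apply: le_trans (coord_le_norm ((x : euclid R d) - y) j).
  by rewrite !mxE.
apply/cvg_ex; exists (l : euclid R d).
apply/(@cvgrPdist_le R (euclid R d)) => e e0.
have de0 : 0 < e / d.+1%:R by rewrite divr_gt0.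
have := Fl _ (nbhsx_ballx l _ de0).
apply: filterS => x [_ lx].
apply: le_trans (norm_le_sum_coord _) _.
apply: (@le_trans _ _ (\sum_(i < d) e / d.+1%:R)).
  by apply: ler_sum => i _; rewrite !mxE; exact/ltW/(lx 0 i).
rewrite sumr_const card_ord -[leLHS]mulr_natr mulrAC ler_pdivrMr// ler_pM2l//.
by rewrite ler_nat.
Qed.

End euclid_complete.

HB.instance Definition _ (R : realType) (d : nat) :=
  Uniform_isComplete.Build (euclid R d) (@euclid_cauchy_cvg R d).

Definition spherical_code (R : realType) (d n : nat) (theta : R)
    (tau : 'I_n -> euclid R d) : Prop :=
  (forall j, `|tau j| = 1) /\
  (forall j k, j != k -> inner (tau j) (tau k) <= cos theta).

(* Main.v *)
Require Import Defs.
From mathcomp Require Import all_boot all_order all_algebra.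
From mathcomp Require Import all_classical all_reals all_analysis.
From mathcomp Require Import ring.

(** A functional of norm one that attains its norm at a unit vector of a
    Euclidean space is the inner product with that vector
    ([norming_functional_inner]), because the Euclidean ball is smooth
    ([norming_functional_orthogonal]).
    Indeed the hyperplane [f = 1] supports the unit ball at [t], and the only
    supporting hyperplane there is orthogonal to [t]: if [y] is orthogonal to
    [t], then [1 + s * f y = f (t + s *: y)] is at most [`|t + s *: y|], whose
    square [1 + s ^+ 2 * `|y| ^+ 2] is flat to first order at [s = 0], so the
    slope [f y] vanishes.  Writing a general vector as its projection on [t]
    plus an orthogonal part gives [f x = inner x t].

    So every functional of a functional code is determined by its vector, and
    the condition on [f j (tau k)] becomes the condition on inner products.
    Conversely, by the Cauchy-Schwarz inequality the functional
    [inner ^~ (tau j)] has norm one and attains it at [tau j]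
    ([dual_norm_attained]). *)

Set Implicit Arguments.
Unset Strict Implicit.
Unset Printing Implicit Defensive.

Import Order.TTheory GRing.Theory Num.Theory.
Import numFieldNormedType.Exports.

Local Open Scope classical_set_scope.
Local Open Scope ring_scope.

Section dual_norm.
Variables (R : realType) (X : normedModType R).

Lemma dual_norm_bound (f : dual X) (x : X) : `|f x| <= dual_norm f * `|x|.
Proof.
have [->|x0] := eqVneq x 0; first by rewrite linear0 !normr0 mulr0.
have nx0 : 0 < `|x| by rewrite normr_gt0.
rewrite -ler_pdivrMr//.
apply: ub_le_sup; first exact: (dual_norm_has_sup f).2.
exists (`|x|^-1 *: x) => /=.
  by rewrite normrZ normfV normr_id mulVf// gt_eqF.
by rewrite linearZ /= normrZ normfV normr_id mulrC.
Qed.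

Lemma dual_norm_attained (f : dual X) (t : X) :
  (forall x, `|f x| <= `|x|) -> `|t| = 1 -> f t = 1 -> dual_norm f = 1.
Proof.
move=> fle t1 ft1; apply/eqP; rewrite eq_le; apply/andP; split.
  apply: ge_sup; first exact: (dual_norm_has_sup f).1.
  by move=> _ [x /= x1 <-]; exact: le_trans (fle x) x1.
by have := dual_norm_bound f t; rewrite t1 ft1 normr1 mulr1.
Qed.

End dual_norm.

Section euclid_functional.
Variables (R : realType) (d : nat).
Implicit Types x y t : euclid R d.

Lemma normr_inner_le x y : `|inner x y| <= `|x| * `|y|.
Proof.
rewrite ler_norml lerNl inner_le andbT.
by rewrite -mulN1r -innerZl scaleN1r -[`|x|]normrN inner_le.
Qed.

Lemma inner_self_unit t : `|t| = 1 -> inner t t = 1.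
Proof. by move=> t1; rewrite -sqr_l2norm -euclid_normE t1 expr1n. Qed.

Lemma sqr_norm_orthogonalD (s : R) t y : inner y t = 0 ->
  `|t + s *: y| ^+ 2 = `|t| ^+ 2 + s ^+ 2 * `|y| ^+ 2.
Proof.
move=> yt; rewrite !euclid_normE !sqr_l2norm.
rewrite innerDl innerZl !(innerC _ (t + _)) !innerDl !innerZl yt (innerC t y) yt.
by ring.
Qed.

(** A linear form dominated by the norm can grow from a unit vector only to
    first order in a direction [y], while the norm grows only to second order
    when [y] is orthogonal. *)
Lemma norming_functional_orthogonal (f : dual (euclid R d)) t y :
  (forall x, `|f x| <= `|x|) -> `|t| = 1 -> f t = 1 -> inner y t = 0 ->
  f y = 0.
Proof.
move=> fle t1 ft1 yt.
set a : R := f y; set b := `|y| ^+ 2.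
have b0 : 0 <= b by rewrite sqr_ge0.
have step (s : R) : (1 + s * a) ^+ 2 <= 1 + s ^+ 2 * b.
  have -> : 1 + s * a = f (t + s *: y) by rewrite linearD linearZ /= ft1.
  have -> : 1 + s ^+ 2 * b = `|t + s *: y| ^+ 2.
    by rewrite sqr_norm_orthogonalD// t1 expr1n.
  by rewrite -[leLHS]real_normK ?num_real// ler_sqr ?nnegrE// fle.
(* A step proportional to [a] makes the linear gain [2 * s * a] nonnegative;
   the factor [(b + 1)^-1] keeps the quadratic term [s ^+ 2 * b] below it
   when [a] is nonzero. *)
have b1 : 0 < b + 1 by rewrite ltr_wpDl.
have bn0 : b + 1 != 0 by rewrite gt_eqF.
have := step (a / (b + 1)).
rewrite -subr_ge0.
have -> : 1 + (a / (b + 1)) ^+ 2 * b - (1 + a / (b + 1) * a) ^+ 2 =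
    - (a ^+ 2 * (b + 2 + a ^+ 2)) / (b + 1) ^+ 2 by field.
rewrite pmulr_lge0 ?invr_gt0 ?exprn_gt0// oppr_ge0.
have c0 : 0 < b + 2 + a ^+ 2 by rewrite ltr_pwDl ?sqr_ge0// ltr_wpDl.
rewrite pmulr_lle0// => a2.
by apply/eqP; rewrite -sqrf_eq0 eq_le a2 sqr_ge0.
Qed.

Lemma norming_functional_inner (f : dual (euclid R d)) t x :
  dual_norm f = 1 -> `|t| = 1 -> f t = 1 -> f x = inner x t.
Proof.
move=> f1 t1 ft1.
have fle z : `|f z| <= `|z| by have := dual_norm_bound f z; rewrite f1 mul1r.
have orth : inner (x + (- inner x t) *: t) t = 0.
  by rewrite innerDl innerZl inner_self_unit// mulr1 subrr.
have := norming_functional_orthogonal fle t1 ft1 orth.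
by rewrite linearD linearZ /= ft1 [_ *: _]mulr1 => /eqP; rewrite subr_eq0 => /eqP.
Qed.

End euclid_functional.

Theorem proposition2p7 (R : realType) (d n : nat) (hd : (1 <= d)%N)
    (hn : (1 <= n)%N) (theta : R) (htheta0 : 0 <= theta)
    (htheta2pi : theta < 2 * pi) (f : 'I_n -> dual (euclid R d))
    (tau : 'I_n -> euclid R d) :
  functional_code theta f tau <->
  spherical_code theta tau /\
  (forall (j : 'I_n) (x : euclid R d), f j x = inner x (tau j)).
Proof.
split=> [[f1 t1 ft1 fcos]|[[t1 tcos] fE]].
  have fE j x : f j x = inner x (tau j) by exact: norming_functional_inner.
  split=> //; split=> // j k jk.
  by rewrite innerC -fE; exact: fcos.
have ft1 j : f j (tau j) = 1 by rewrite fE inner_self_unit.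
split=> // [j|j k jk]; last by rewrite fE innerC; exact: tcos.
apply: (dual_norm_attained _ (t1 j) (ft1 j)) => x.
by rewrite fE; have := normr_inner_le x (tau j); rewrite t1 mulr1.
Qed.
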